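(* Let $|\cdot|$ be a non-trivial absolute value on $\mathbb{Q}$. Then one of the following must hold: (i) $|\cdot|=|\cdot|_\infty^\alpha$ for some $\alpha\in(0,1]$; or (ii) $|\cdot|=|\cdot|_p^\alpha$ for some $\alpha\in(0,\infty)$ and some prime $p\in\mathbb{N}_+$.
   Context: The setting is constructive (geometric) mathematics, valid over any base topos with natural numbers object. Real numbers are Dedekind sections, unless stated to be upper reals (only the right, rounded upward closed, section of rationals is given). An absolute value on a discrete commutative ring $R$ is a map $|\cdot|$ from $R$ to the non-negative finite upper reals with $|0|=0$, $|1|=1$, $|xy|=|x||y|$, $|x+y|\le|x|+|y|$. It is Dedekind if its values are given as Dedekind reals in $[0,\infty)$, and a Dedekind absolute value is positive definite if for every $x\in R$, $x=0$ or $|x|>0$. Every absolute value on $\mathbb{Q}$ is canonically Dedekind and positive definite, and absolute values on $\mathbb{Q}$ are identified with positive definite Dedekind absolute values on $\mathbb{Z}$ by restriction. An absolute value on $\mathbb{Q}$ is non-Archimedean if $|n|<1$ for some non-zero integer $n$; it is non-trivial Archimedean if $|n|>1$ for some non-zero integer $n$. It is non-trivial if it is non-Archimedean or non-trivial Archimedean. $|\cdot|_\infty$ is the usual (Euclidean) absolute value. For a prime $p$, $|\cdot|_p$ is the $p$-adic absolute value, $|n|_p=p^{-\mathrm{ord}_p(n)}$ for non-zero integers $n$, where $\mathrm{ord}_p(n)$ is the largest $r\in\mathbb{N}$ such that $p^r$ divides $n$, with $|0|_p=0$ and $|m/n|_p=|m|_p/|n|_p$. $|\cdot|^\alpha$ denotes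 the map $x\mapsto|x|^\alpha$. Here $\alpha$ is a Dedekind real. $\mathbb{N}_+$ is the set of positive integers. *)

(* Defs.v *)
From mathcomp Require Import all_boot all_order all_algebra.
From mathcomp Require Import ring lra.

Set Implicit Arguments.
Unset Strict Implicit.
Unset Printing Implicit Defensive.

Import Order.TTheory GRing.Theory Num.Theory.
Local Open Scope ring_scope.

(* Real numbers are given by sections of the rationals and everything below is
   constructive: all strict comparisons with rationals are propositions, and
   equality of reals is the equivalence of their sections. *)

(* Non-negative finite upper reals. [ltur x q] means x < q. *)
Record ureal := UReal {
  ltur : rat -> Prop;
  ltur_up : forall q r, q < r -> ltur q -> ltur r;
  ltur_round : forall q, ltur q -> exists2 r, r < q & ltur r;
  ltur_fin : exists q, ltur q;
  ltur_gt0 : forall q, ltur q -> 0 < q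
}.

Definition ueq (x y : ureal) : Prop := forall q, ltur x q <-> ltur y q.
Definition ule (x y : ureal) : Prop := forall q, ltur y q -> ltur x q.

Lemma urat_up (a : rat) q r : q < r -> a < q -> a < r.
Proof. by move=> qr aq; apply: lt_trans qr. Qed.

Lemma urat_round (a : rat) q : a < q -> exists2 r, r < q & a < r.
Proof. by move=> aq; exists ((a + q) / 2); lra. Qed.

Lemma urat_fin (a : rat) : exists q, a < q.
Proof. by exists (a + 1); lra. Qed.

Lemma urat_gt0 (a : rat) : 0 <= a -> forall q, a < q -> 0 < q.
Proof. by move=> a0 q; apply: le_lt_trans. Qed.

Definition urat (a : rat) (a_ge0 : 0 <= a) : ureal :=
  UReal (@urat_up a) (@urat_round a) (urat_fin a) (urat_gt0 a_ge0).

Definition uzero : ureal := urat (lexx 0).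
Definition uone : ureal := urat ler01.

Section UpperArith.
Variables x y : ureal.

Definition uadd_sec (q : rat) : Prop :=
  exists a b, [/\ ltur x a, ltur y b & q = a + b].
Definition umul_sec (q : rat) : Prop :=
  exists a b, [/\ ltur x a, ltur y b & q = a * b].

Lemma uadd_up q r : q < r -> uadd_sec q -> uadd_sec r.
Proof.
move=> qr [a [b [xa yb qE]]]; exists a, (r - a); split => //; last by ring.
by apply: ltur_up yb; lra.
Qed.

Lemma uadd_round q : uadd_sec q -> exists2 r, r < q & uadd_sec r.
Proof.
move=> [a [b [xa yb ->]]]; have [a' a'a xa'] := ltur_round xa.
by exists (a' + b); [lra | exists a', b].
Qed.

Lemma uadd_fin : exists q, uadd_sec q.
Proof.
by have [[a xa] [b yb]] := (ltur_fin x, ltur_fin y); exists (a + b), a, b.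
Qed.

Lemma uadd_gt0 q : uadd_sec q -> 0 < q.
Proof.
by move=> [a [b [/ltur_gt0 a0 /ltur_gt0 b0 ->]]]; apply: addr_gt0.
Qed.

Lemma umul_up q r : q < r -> umul_sec q -> umul_sec r.
Proof.
move=> qr [a [b [xa yb qE]]]; have a0 := ltur_gt0 xa.
exists a, (r / a); split => //; last by rewrite mulrC divfK ?gt_eqF.
by apply: ltur_up yb; rewrite ltr_pdivlMr // mulrC -qE.
Qed.

Lemma umul_round q : umul_sec q -> exists2 r, r < q & umul_sec r.
Proof.
move=> [a [b [xa yb ->]]]; have [a' a'a xa'] := ltur_round xa.
exists (a' * b); last by exists a', b.
by rewrite ltr_pM2r // (ltur_gt0 yb).
Qed.

Lemma umul_fin : exists q, umul_sec q.
Proof.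
by have [[a xa] [b yb]] := (ltur_fin x, ltur_fin y); exists (a * b), a, b.
Qed.

Lemma umul_gt0 q : umul_sec q -> 0 < q.
Proof.
by move=> [a [b [/ltur_gt0 a0 /ltur_gt0 b0 ->]]]; apply: mulr_gt0.
Qed.

Definition uadd : ureal := UReal uadd_up uadd_round uadd_fin uadd_gt0.
Definition umul : ureal := UReal umul_up umul_round umul_fin umul_gt0.

End UpperArith.

(* Dedekind reals. [dlt_rat x q] means x < q and [rat_dlt x q] means q < x. *)
Record dreal := DReal {
  rat_dlt : rat -> Prop;
  dlt_rat : rat -> Prop;
  rat_dlt_down : forall q r, q < r -> rat_dlt r -> rat_dlt q;
  rat_dlt_round : forall q, rat_dlt q -> exists2 r, q < r & rat_dlt r;
  rat_dlt_fin : exists q, rat_dlt q;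
  dlt_rat_up : forall q r, q < r -> dlt_rat q -> dlt_rat r;
  dlt_rat_round : forall q, dlt_rat q -> exists2 r, r < q & dlt_rat r;
  dlt_rat_fin : exists q, dlt_rat q;
  dreal_disjoint : forall q, rat_dlt q -> dlt_rat q -> False;
  dreal_located : forall q r, q < r -> rat_dlt q \/ dlt_rat r
}.

(* For an upper real x, [ltru q x] says q < x through an intermediate rational.
   By [ltru_dedekind] this is the lower section of any Dedekind real whose
   upper section is x. *)
Definition ltru (q : rat) (x : ureal) : Prop :=
  exists2 r, q < r & forall s, ltur x s -> r <= s.

Definition is_dedekind (x : ureal) (d : dreal) : Prop :=
  forall q, dlt_rat d q <-> ltur x q.

Lemma ltru_dedekind (x : ureal) (d : dreal) :
  is_dedekind x d -> forall q, rat_dlt d q <-> ltru q x.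
Proof.
move=> xd q; split=> [/rat_dlt_round [r qr dr]|[r qr rx]].
  exists r => // s /xd ds; case: leP => // sr.
  by case: (@dreal_disjoint d r) => //; apply: dlt_rat_up ds.
have [//|/xd/ltur_round [s sr /rx]] := @dreal_located d q r qr.
by rewrite leNgt sr.
Qed.

Section AbsoluteValue.
Variable R : comPzRingType.

Record absolute_value (v : R -> ureal) : Prop := AbsoluteValue {
  abs0 : ueq (v 0) uzero;
  abs1 : ueq (v 1) uone;
  absM : forall x y, ueq (v (x * y)) (umul (v x) (v y));
  absD : forall x y, ule (v (x + y)) (uadd (v x) (v y))
}.

End AbsoluteValue.

(* Every absolute value on Q is Dedekind, so that [ltru] is the strict order
   on its values. *)
Lemma abs_rat_located (v : rat -> ureal) : absolute_value v ->
  forall (x q r : rat), q < r -> ltru q (v x) \/ ltur (v x) r.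
Proof.
move=> hv x q r qr; case: (ltP q 0) => [q0|q0].
  by left; exists 0 => // s /ltur_gt0/ltW.
have [->|x0] := eqVneq x 0.
  by right; apply/(abs0 hv) => /=; apply: le_lt_trans qr.
pose m := (q + r) / 2; have [qm mr] : q < m /\ m < r by rewrite /m; lra.
have m0 : 0 < m by apply: le_lt_trans qm.
have : ltur (v (x * x^-1)) (r / m).
  by rewrite divff //; apply/(abs1 hv); rewrite /= ltr_pdivlMr // mul1r.
move=> /(absM hv) [a [b [xa xb abE]]].
have [a0 b0] := (ltur_gt0 xa, ltur_gt0 xb).
case: (ltP a r) => [ar|ra]; first by right; apply: ltur_up xa.
left; exists m => // s xs.
have : ltur (v (x * x^-1)) (s * b) by apply/(absM hv); exists s, b.
rewrite divff // => /(abs1 hv) /= sb1.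
have mab : r = a * b * m by rewrite -abE divfK ?gt_eqF.
have bm1 : b * m <= 1.
  rewrite -(ler_pM2l a0) mulr1 mulrA -mab //.
apply: ltW; rewrite -(ltr_pM2r b0) mulrC.
exact: le_lt_trans sb1.
Qed.

Lemma abs_rat_dedekind (v : rat -> ureal) : absolute_value v ->
  forall x : rat, exists d : dreal, is_dedekind (v x) d.
Proof.
move=> hv x.
have ddown q r : q < r -> ltru r (v x) -> ltru q (v x).
  by move=> qr [s rs sx]; exists s => //; apply: lt_trans rs.
have dround q : ltru q (v x) -> exists2 r, q < r & ltru r (v x).
  move=> [s qs sx]; exists ((q + s) / 2); first by lra.
  by exists s => //; lra.
have dfin : exists q, ltru q (v x).
  by exists (-1), 0 => // s /ltur_gt0/ltW.
have ddisj q : ltru q (v x) -> ltur (v x) q -> False.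
  by move=> [s qs sx] /sx; rewrite leNgt qs.
by exists (DReal ddown dround dfin (@ltur_up (v x)) (@ltur_round (v x))
  (ltur_fin (v x)) ddisj (abs_rat_located hv x)).
Qed.

Definition non_archimedean (v : rat -> ureal) : Prop :=
  exists2 n : int, n != 0 & ltur (v n%:~R) 1.

Definition nontrivial_archimedean (v : rat -> ureal) : Prop :=
  exists2 n : int, n != 0 & ltru 1 (v n%:~R).

Definition nontrivial (v : rat -> ureal) : Prop :=
  non_archimedean v \/ nontrivial_archimedean v.

Definition abs_infty (x : rat) : ureal := urat (normr_ge0 x).

Definition padic_int (p : nat) (n : int) : rat :=
  if n == 0 then 0 else p%:R ^- logn p `|n|%N.

Definition padic_rat (p : nat) (x : rat) : rat :=
  padic_int p (numq x) / padic_int p (denq x).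

Lemma padic_int_ge0 p n : 0 <= padic_int p n.
Proof. by rewrite /padic_int; case: eqP => // _; rewrite invr_ge0 exprn_ge0. Qed.

Lemma padic_rat_ge0 p x : 0 <= padic_rat p x.
Proof. by rewrite divr_ge0 ?padic_int_ge0. Qed.

Definition abs_padic (p : nat) (x : rat) : ureal := urat (padic_rat_ge0 p x).

(* a ^ alpha < q for rational a > 0: the power a ^ r is non-decreasing in the
   rational r = m / k if a >= 1 and non-increasing if a <= 1, so a ^ alpha is
   the infimum of the a ^ r over r > alpha, respectively r < alpha; and
   a ^ (m / k) < q is a ^ m < q ^ k. *)
Definition rpow_lt (a : rat) (alpha : dreal) (q : rat) : Prop :=
  0 < q /\ exists (m : int) (k : nat),
    [/\ (0 < k)%N,
        (1 <= a /\ dlt_rat alpha (m%:~R / k%:R)) \/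
        (a <= 1 /\ rat_dlt alpha (m%:~R / k%:R))
      & a ^ m < q ^+ k].

Lemma bernoulli (e : rat) k : 0 <= e <= 1 -> 1 - k%:R * e <= (1 - e) ^+ k.
Proof.
move=> /andP[e0 e1]; elim: k => [|k IHk]; first by rewrite expr0; lra.
have f0 : 0 <= 1 - e by lra.
rewrite exprS; apply: le_trans (ler_wpM2l f0 IHk).
have : 0 <= k%:R * (e * e) by rewrite !mulr_ge0.
by rewrite -natr1; lra.
Qed.

Lemma pow_round (c q : rat) k : 0 < c -> 0 < q -> (0 < k)%N -> c < q ^+ k ->
  exists2 r, r < q & 0 < r /\ c < r ^+ k.
Proof.
move=> c0 q0 k0 cq; have qk0 : 0 < q ^+ k by rewrite exprn_gt0.
have kR : 1 <= k%:R :> rat by rewrite ler1n.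
have kR0 : 0 < k%:R :> rat by apply: lt_le_trans kR.
pose t := c / q ^+ k.
have t0 : 0 < t by rewrite divr_gt0.
have t1 : t < 1 by rewrite ltr_pdivrMr // mul1r.
pose e := (1 - t) / 2 / k%:R.
have e0 : 0 < e by rewrite !divr_gt0 //; lra.
have ke : k%:R * e = (1 - t) / 2 by rewrite mulrC divfK ?gt_eqF.
have e1 : e < 1.
  have : 1 * e <= k%:R * e by rewrite ler_pM2r.
  by rewrite ke mul1r; lra.
have := @bernoulli e k; rewrite (ltW e0) (ltW e1) ke => /(_ isT) be.
exists (q * (1 - e)); first by rewrite gtr_pMr //; lra.
split; first by rewrite mulr_gt0 //; lra.
rewrite exprMn mulrC -ltr_pdivrMr // -/t.
by apply: lt_le_trans be; lra.
Qed.

Section Power.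
Variables (x : ureal) (alpha : dreal).

(* x ^ alpha for alpha > 0, as the infimum of the a ^ alpha over the rationals
   a > x; the latter are positive, which avoids powers of 0. For alpha <= 0
   this is not the usual power. *)
Definition upow_sec (q : rat) : Prop := exists2 a, ltur x a & rpow_lt a alpha q.

Lemma upow_up q r : q < r -> upow_sec q -> upow_sec r.
Proof.
move=> qr [a xa [q0 [m [k [k0 h aq]]]]]; exists a => //.
split; first exact: lt_trans qr.
exists m, k; split => //; apply: lt_trans aq _.
by rewrite ltrXn2r ?(ltW q0) // -?lt0n // ?lt_def.
Qed.

Lemma upow_round q : upow_sec q -> exists2 r, r < q & upow_sec r.
Proof.
move=> [a xa [q0 [m [k [k0 h aq]]]]].
have [|r rq [r0 ar]] := pow_round _ q0 k0 aq.
  by rewrite exprz_gt0 // (ltur_gt0 xa).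
by exists r => //; exists a => //; split => //; exists m, k.
Qed.

Lemma upow_fin : exists q, upow_sec q.
Proof.
have [a xa] := ltur_fin x.
have [s hs] : exists s : rat,
    (1 <= a /\ dlt_rat alpha s) \/ (a <= 1 /\ rat_dlt alpha s).
  have [u hu] := dlt_rat_fin alpha; have [l hl] := rat_dlt_fin alpha.
  by case: (leP 1 a) => [a1|/ltW a1]; [exists u; left | exists l; right].
have am0 : 0 < a ^ numq s by rewrite exprz_gt0 // (ltur_gt0 xa).
exists (a ^ numq s + 1), a => //; split; first by lra.
exists (numq s), `|denq s|%N; split; first by rewrite absz_gt0 denq_neq0.
  by rewrite pmulrn absz_denq divq_num_den.
apply: (@lt_le_trans _ _ (a ^ numq s + 1)); first by lra.
by rewrite ler_eXnr ?absz_gt0 ?denq_neq0 //; lra.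
Qed.

Lemma upow_gt0 q : upow_sec q -> 0 < q.
Proof. by move=> [a _ []]. Qed.

Definition upow : ureal := UReal upow_up upow_round upow_fin upow_gt0.

End Power.

(* The equality v = w ^ alpha of maps from R to the upper reals. *)
Definition is_power_of (R : Type) (v w : R -> ureal) (alpha : dreal) : Prop :=
  forall x, ueq (v x) (upow (w x) alpha).

Definition dpos (alpha : dreal) : Prop := rat_dlt alpha 0.
Definition dle1 (alpha : dreal) : Prop := forall q, 1 < q -> dlt_rat alpha q.

(* Main.v *)
(* Write |.| for the absolute value and L for its logarithm to a base b. Every
   step is a comparison of rational bounds, so that no excluded middle is used.

   If |b| < c with 1 <= c, expanding a^(s j) in base b and letting j grow shows
   that a^s < b^t implies |a|^s <= c^t. With |b| < 1 for a prime b = p this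
   gives |n| <= 1 for all integers n, and |n| = 1 for n prime to p by Bezout;
   with |b| > 1 it gives |n| = n^(L b) for all n >= 1.

   In both cases the equality |x| = w(x)^alpha is reduced to an inequality for x
   and x^-1. That inequality is weakened to |x|^k <= C w(x)^m for a constant C
   that depends only on x and all m/k < alpha < (m+2)/k. The weak form is
   multiplicative in x, so that it is enough to prove it for the primes and
   their inverses. *)
Require Import Defs.
From mathcomp Require Import all_boot all_order all_algebra.
From mathcomp Require Import zify ring lra.

Set Implicit Arguments.
Unset Strict Implicit.
Unset Printing Implicit Defensive.

Import Order.TTheory GRing.Theory Num.Theory.
Local Open Scope ring_scope.

(** * Growth of powers *)

Lemma le_1Dn_exp (h : rat) n : 0 <= h -> 1 + n%:R * h <= (1 + h) ^+ n.
Proof.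
move=> h0; elim: n => [|n IHn]; first by rewrite expr0; lra.
rewrite exprS; apply: (@le_trans _ _ ((1 + h) * (1 + n%:R * h))).
  have : 0 <= n%:R * (h * h) by rewrite !mulr_ge0.
  by rewrite -natr1; lra.
by rewrite ler_pM2l //; lra.
Qed.

Lemma exists_natr_gt (x : rat) : exists n : nat, x < n%:R.
Proof.
exists (Num.bound `|x|); apply: le_lt_trans (ler_norm x) _.
exact: archi_boundP.
Qed.

(** With j = 2 i, Bernoulli's inequality for t^i, once squared, gives a term quadratic in i, which
    outgrows A + B j. With B = 0 this serves to absorb constants. *)
Lemma exp_gt_linear (t A B : rat) K : 1 < t ->
  exists2 j : nat, (K < j)%N & A + B * j%:R < t ^+ j.
Proof.
move=> t1; pose h := t - 1; have h0 : 0 < h by rewrite /h; lra.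
have hh0 : 0 < h ^+ 2 by rewrite exprn_gt0.
have [N] := exists_natr_gt ((`|A| + 2 * `|B|) / h ^+ 2).
rewrite ltr_pdivrMr // => hN; pose i := (N + K).+1.
exists (2 * i)%N; first by rewrite /i; lia.
have iN : N%:R <= i%:R :> rat by rewrite ler_nat /i; lia.
have i1 : 1 <= i%:R :> rat by rewrite ler1n.
have -> : t = 1 + h by rewrite /h; ring.
have ih0 : 0 < i%:R * h by rewrite mulr_gt0 //; lra.
apply: (@lt_le_trans _ _ ((1 + i%:R * h) ^+ 2)); last first.
  rewrite mulnC exprM lerXn2r ?nnegrE ?exprn_ge0 //; try lra.
  by apply: le_1Dn_exp; lra.
have hA := ler_norm A; have hB := ler_norm B; have nA := normr_ge0 A.
have iA : `|A| <= i%:R * `|A| by rewrite ler_peMl.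
have iB : B * i%:R <= `|B| * i%:R by rewrite ler_wpM2r.
have ihN : N%:R * h ^+ 2 <= i%:R * h ^+ 2 by rewrite ler_wpM2r // ltW.
have : i%:R * (`|A| + 2 * `|B|) < i%:R * (i%:R * h ^+ 2).
  by rewrite ltr_pM2l //; lra.
rewrite natrM; move: ih0; set u := i%:R * h.
have -> : i%:R * (i%:R * h ^+ 2) = u ^+ 2 by rewrite /u; ring.
move: hh0; rewrite !expr2.
lra.
Qed.

(** * Basic estimates for an absolute value on the rationals *)

Lemma ltur_le (x : ureal) q r : q <= r -> ltur x q -> ltur x r.
Proof. by rewrite le_eqVlt => /predU1P[->//|]; apply: ltur_up. Qed.

Section AbsRat.
Variable v : rat -> ureal.
Hypothesis v_abs : absolute_value v.

Lemma abs_lt_mul x y a b :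
  ltur (v x) a -> ltur (v y) b -> ltur (v (x * y)) (a * b).
Proof. by move=> xa yb; apply/(absM v_abs); exists a, b. Qed.

Lemma abs_lt_add x y a b :
  ltur (v x) a -> ltur (v y) b -> ltur (v (x + y)) (a + b).
Proof. by move=> xa yb; apply: (absD v_abs); exists a, b. Qed.

Lemma abs1_lt q : ltur (v 1) q <-> 1 < q.
Proof. exact: (abs1 v_abs). Qed.

Lemma abs_lt_exp x a k : (0 < k)%N ->
  ltur (v x) a -> ltur (v (x ^+ k)) (a ^+ k).
Proof.
case: k => // k _ xa; elim: k => [|k IHk]; first by rewrite !expr1.
by rewrite exprS (exprS a); apply: abs_lt_mul.
Qed.

(** A bound on a product of k copies of x splits into k bounds on x; the smallest of them is a
    rational substitute for the k-th root of q. *)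
Lemma abs_lt_root x q k :
  ltur (v (x ^+ k)) q -> exists2 a, ltur (v x) a & a ^+ k <= q.
Proof.
elim: k q => [|k IHk] q.
  have [a xa] := ltur_fin (v x).
  by rewrite expr0 => /abs1_lt/ltW q1; exists a.
rewrite exprS => /(absM v_abs)[a [b [xa /IHk[c xc cb] ->]]].
have [a0 c0] := (ltur_gt0 xa, ltur_gt0 xc).
exists (Num.min a c); first by case: leP.
have m0 : 0 <= Num.min a c by rewrite le_min !ltW.
rewrite exprS ler_pM ?exprn_ge0 ?ge_min ?lexx //.
by apply: le_trans cb; rewrite lerXn2r ?nnegrE ?ge_min ?lexx ?orbT // ltW.
Qed.

Lemma abs_lt_expE x q k : (0 < k)%N -> 0 < q ->
  ltur (v (x ^+ k)) (q ^+ k) <-> ltur (v x) q.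
Proof.
move=> k0 q0; split=> [/abs_lt_root[a xa]|]; last exact: abs_lt_exp.
rewrite ler_pXn2r ?nnegrE ?(ltW q0) ?(ltW (ltur_gt0 xa)) // => /ltur_le.
exact.
Qed.

Lemma abs_inv_gt1 x a b :
  x != 0 -> ltur (v x) a -> ltur (v x^-1) b -> 1 < a * b.
Proof.
by move=> x0 xa xb; apply/abs1_lt; rewrite -(divff x0); apply: abs_lt_mul.
Qed.

(** As r / q > 1 = |x| |x^-1|, it splits as a b with a, b bounds for x and x^-1; the decidable
    comparison of a with r selects the alternative. *)
Lemma abs_locate x q r : x != 0 -> 0 < q -> q < r ->
  ltur (v x^-1) q^-1 \/ ltur (v x) r.
Proof.
move=> x0 q0 qr; have : ltur (v 1) (r / q).
  by apply/abs1_lt; rewrite ltr_pdivlMr ?mul1r.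
rewrite -(divff x0) => /(absM v_abs)[a [b [xa xb abE]]].
case: (leP a r) => [ar|ra]; [right; exact: ltur_le xa|left].
apply: ltur_le xb; rewrite -(ler_pM2l (ltur_gt0 xa)) -abE ler_pM2r ?invr_gt0 //.
exact: ltW.
Qed.

Lemma abs0_lt q : ltur (v 0) q <-> 0 < q.
Proof. exact: (abs0 v_abs). Qed.

Lemma abs_natr_lt n q : n%:R < q -> ltur (v n%:R) q.
Proof.
elim: n q => [|n IHn] q nq; first by apply/abs0_lt.
rewrite -natr1 in nq *.
have -> : q = (n%:R + (q - (n%:R + 1)) / 2) + (1 + (q - (n%:R + 1)) / 2) by lra.
by apply: abs_lt_add; [apply: IHn|apply/abs1_lt]; lra.
Qed.

Lemma absN1_lt q : 1 < q -> ltur (v (- 1)) q.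
Proof.
move=> q1; apply/(@abs_lt_expE _ _ 2) => //; first by lra.
by rewrite sqrrN expr1n; apply/abs1_lt; rewrite exprn_egt1.
Qed.

Lemma absN_lt x q : ltur (v x) q -> ltur (v (- x)) q.
Proof.
move=> /ltur_round[r rq xr]; have r0 := ltur_gt0 xr.
rewrite -mulN1r -(divfK (lt0r_neq0 r0) q); apply: abs_lt_mul => //.
by apply: absN1_lt; rewrite ltr_pdivlMr // mul1r.
Qed.

(** * The logarithm of an absolute value as a Dedekind real *)

Section Log.
Variables (b : rat) (b_gt1 : 1 < b).
Let b_gt0 : 0 < b. Proof. exact: lt_trans ltr01 b_gt1. Qed.

Lemma abs_log_le x (m m' : int) (k k' : nat) : (0 < k)%N -> (0 < k')%N ->
  m * k'%:Z <= m' * k%:Z ->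
  ltur (v (x ^+ k)) (b ^ m) -> ltur (v (x ^+ k')) (b ^ m').
Proof.
move=> k0 k'0 mk /(abs_lt_exp k'0) xk.
apply/(abs_lt_expE _ k0); first exact: exprz_gt0.
move: xk; rewrite -!exprM mulnC; apply: ltur_le.
by rewrite ![_ ^+ _]exprnP !exprz_exp ler_eXz2l.
Qed.

(* log_b |x| < s, with the power taken on the side of x to avoid roots. *)
Definition log_lt (x s : rat) : Prop := ltur (v (x ^+ `|denq s|)) (b ^ numq s).

Lemma absz_denq_gt0 (s : rat) : (0 < `|denq s|)%N.
Proof. by rewrite absz_gt0 denq_neq0. Qed.

(** [log_lt] is defined through the reduced fraction; this makes every representation m / k
    available. *)
Lemma log_ltP x (m : int) (k : nat) : (0 < k)%N ->
  log_lt x (m%:~R / k%:R) <-> ltur (v (x ^+ k)) (b ^ m).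
Proof.
move=> k0; set s := m%:~R / _.
have sE : numq s * k%:Z = m * `|denq s|%N%:Z.
  rewrite absz_denq; apply/eqP; rewrite -(eqr_int rat) !intrM.
  have : s = (numq s)%:~R / (denq s)%:~R by rewrite divq_num_den.
  rewrite {1}/s => /eqP.
  rewrite eqr_div ?pnatr_eq0 -?lt0n ?intr_eq0 ?denq_neq0 //.
  by move=> /eqP ->; rewrite pmulrn.
by split; apply: abs_log_le; rewrite ?sE // absz_denq_gt0.
Qed.

Lemma log_lt_up x q r : q < r -> log_lt x q -> log_lt x r.
Proof.
move=> qr; apply: abs_log_le; rewrite ?absz_denq_gt0 // !absz_denq.
rewrite -(ler_int rat) !intrM -ler_pdivlMr ?ltr0z ?denq_gt0 //.
by rewrite mulrAC -ler_pdivrMr ?ltr0z ?denq_gt0 // !divq_num_den ltW.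
Qed.

Lemma log_lt_round x q : log_lt x q -> exists2 r, r < q & log_lt x r.
Proof.
rewrite -{1 2}(divq_num_den q) -absz_denq; move: (absz_denq_gt0 q).
move: (numq q) `|denq q|%N => m k k0 /(log_ltP _ _ k0)/ltur_round[c cb xc].
have c0 := ltur_gt0 xc.
have [|N N0 bN] := @exp_gt_linear (b ^ m / c) b 0 0.
  by rewrite ltr_pdivlMr // mul1r.
have kN0 : (0 < k * N)%N by rewrite muln_gt0 k0.
(* N satisfies b c^N < b^(m N), which leaves room to lower the exponent m N by 1. *)
exists ((m * N%:Z - 1)%:~R / (k * N)%:R).
  rewrite ltr_pdivrMr ?ltr0n // natrM mulrA divfK ?pnatr_eq0 -?lt0n //.
  by rewrite intrB intrM ltrBlDr ltrDl.
apply/(log_ltP _ _ kN0); rewrite exprM.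
apply: ltur_le (abs_lt_exp _ xc) => //.
rewrite expfzDr ?gt_eqF // -exprz_exp -exprnP.
move: bN; rewrite mul0r addr0 expr_div_n ltr_pdivlMr ?exprn_gt0 // => bN.
by rewrite (_ : b ^ (-1) = b^-1) // ler_pdivlMr // mulrC ltW.
Qed.

Lemma log_lt_fin x : exists q, log_lt x q.
Proof.
have [c xc] := ltur_fin (v x); have [N _ cN] := exp_gt_linear c 0 0 b_gt1.
exists (N%:Z%:~R / 1%:R); apply/log_ltP => //; rewrite expr1 -exprnP.
by apply: ltur_up xc; rewrite mul0r addr0 in cN.
Qed.

Section DedekindLog.
Variables (x : rat) (x_neq0 : x != 0).

(** Since log_b |x| = - log_b |x^-1|, the lower section of log_b |x| is taken to be the set of q
    with [log_lt x^-1 (- q)]. *)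
Lemma log_gt_down q r : q < r -> log_lt x^-1 (- r) -> log_lt x^-1 (- q).
Proof. by move=> qr; apply: log_lt_up; rewrite ltrN2. Qed.

Lemma log_gt_round q :
  log_lt x^-1 (- q) -> exists2 r, q < r & log_lt x^-1 (- r).
Proof.
by move=> /log_lt_round[r rq xr]; exists (- r); rewrite ?opprK // ltrNr.
Qed.

Lemma log_gt_fin : exists q, log_lt x^-1 (- q).
Proof. by have [q xq] := log_lt_fin x^-1; exists (- q); rewrite opprK. Qed.

Lemma log_gtP (m : int) (k : nat) : (0 < k)%N ->
  log_lt x^-1 (- (m%:~R / k%:R)) <-> ltur (v (x ^- k)) (b ^ (- m)).
Proof. by move=> k0; rewrite -exprVn -mulNr -intrN log_ltP. Qed.

Lemma log_disjoint q : log_lt x^-1 (- q) -> log_lt x q -> False.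
Proof.
rewrite -(divq_num_den q) -absz_denq; move: (absz_denq_gt0 q).
move: (numq q) `|denq q|%N => m k k0.
move=> /log_gtP - /(_ k0) xVk /(log_ltP _ _ k0) xk.
have := abs_inv_gt1 (expf_neq0 k x_neq0) xk xVk.
by rewrite -expfzDr ?gt_eqF // subrr expr0z ltxx.
Qed.

Lemma log_located q r : q < r -> log_lt x^-1 (- q) \/ log_lt x r.
Proof.
(* Over a common denominator k, q < r compares two integer exponents of b, and [abs_locate] applies
   to x^k. *)
move=> qr; pose k := (`|denq q| * `|denq r|)%N.
have k0 : (0 < k)%N by rewrite muln_gt0 !absz_denq_gt0.
have d0 (s : rat) : (denq s)%:~R != 0 :> rat by rewrite intr_eq0 denq_neq0.
have kE : k%:R = (denq q)%:~R * (denq r)%:~R :> rat.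
  by rewrite natrM !pmulrn !absz_denq.
have qE : q = (numq q * denq r)%:~R / k%:R.
  by rewrite kE intrM -mulf_div divff // mulr1 divq_num_den.
have rE : r = (numq r * denq q)%:~R / k%:R.
  by rewrite kE intrM [X in X / _]mulrC -mulf_div divff // mul1r divq_num_den.
move: qr; rewrite [X in X < _]qE [X in _ < X]rE.
rewrite ltr_pM2r ?invr_gt0 ?ltr0n // ltr_int => mm.
have bmm : b ^ (numq q * denq r) < b ^ (numq r * denq q) by rewrite ltr_eXz2l.
have b0 := exprz_gt0 (numq q * denq r) b_gt0.
case: (abs_locate (expf_neq0 k x_neq0) b0 bmm) => h.
  by left; rewrite qE; apply/log_gtP => //; rewrite -invr_expz.
by right; rewrite rE; apply/log_ltP.
Qed.

Definition dlog : dreal :=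
  DReal log_gt_down log_gt_round log_gt_fin (@log_lt_up x) (@log_lt_round x)
    (log_lt_fin x) log_disjoint log_located.

End DedekindLog.

End Log.
End AbsRat.

(** * Rational approximation of Dedekind reals and of powers *)

Lemma dreal_lt (alpha : dreal) q r :
  rat_dlt alpha q -> dlt_rat alpha r -> q < r.
Proof.
move=> qa ar; case: ltP => //; rewrite le_eqVlt => /predU1P[rq|rq].
  by case: (dreal_disjoint qa); rewrite -rq.
by case: (dreal_disjoint qa); apply: dlt_rat_up ar.
Qed.

(** Walking down the multiples of 1 / k from one above alpha, locatedness decides at each step
    whether to stop. It only separates two distinct points, so the bracket obtained has width 2 /
    k. *)
Lemma dreal_grid (alpha : dreal) k : (0 < k)%N -> dpos alpha ->
  exists m : nat, rat_dlt alpha (m%:R / k%:R) /\ dlt_rat alpha (m.+2%:R / k%:R).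
Proof.
move=> k0 alpha0; have kR : 0 < k%:R :> rat by rewrite ltr0n.
have lt_k (i j : nat) : (i < j)%N -> i%:R / k%:R < j%:R / k%:R :> rat.
  by move=> ij; rewrite ltr_pM2r ?invr_gt0 // ltr_nat.
have grid n : dlt_rat alpha (n.+1%:R / k%:R) ->
    exists m : nat,
      rat_dlt alpha (m%:R / k%:R) /\ dlt_rat alpha (m.+2%:R / k%:R).
  elim: n => [|n IHn] an.
    exists 0%N; split; first by rewrite mul0r.
    by apply: dlt_rat_up an; apply: lt_k.
  case: (dreal_located alpha (lt_k n n.+1 (ltnSn n))) => [na|]; last exact: IHn.
  by exists n.
have [u au] := dlt_rat_fin alpha; have [n un] := exists_natr_gt (u * k%:R).
apply: (grid n); apply: dlt_rat_up au.
by rewrite ltr_pdivlMr // (lt_trans un) // ltr_nat.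
Qed.

(** [pow_round] lowers a base; applied to inverses, it raises w. *)
Lemma exists_gt_exp_lt (w u c : rat) m : 0 < w -> w < u -> w ^+ m < c ->
  exists2 a, w < a <= u & a ^+ m < c.
Proof.
move=> w0 wu wc; have c0 : 0 < c by apply: lt_trans wc; apply: exprn_gt0.
case: m wc => [|m] wc; first by exists u; rewrite ?wu ?lexx // !expr0 in wc *.
have [||//||r rw [r0 cr]] := @pow_round c^-1 w^-1 m.+1; rewrite ?invr_gt0 //.
  by rewrite exprVn ltf_pV2 ?posrE ?exprn_gt0.
have wr : w < r^-1 by rewrite -[w]invrK ltf_pV2 ?posrE ?invr_gt0.
exists (Num.min u r^-1); first by rewrite lt_min wu wr ge_min lexx.
have rV0 : 0 < r^-1 by rewrite invr_gt0.
have m0 : 0 <= Num.min u r^-1 by rewrite le_min !ltW // (lt_trans w0).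
apply: (@le_lt_trans _ _ (r^-1 ^+ m.+1)).
  by rewrite lerXn2r ?nnegrE ?ge_min ?lexx ?orbT // ltW.
by rewrite exprVn -[c]invrK ltf_pV2 ?posrE ?invr_gt0 ?exprn_gt0.
Qed.

(* [v x <= w x ^ alpha] up to a multiplicative constant that is uniform in the
   exponent [k]; taking k-th roots makes the constant disappear. *)
Definition quasi_le (v : rat -> ureal) (w : rat -> rat) (alpha : dreal)
    (x : rat) : Prop :=
  exists2 C : rat, 0 < C & forall k m : nat, (0 < k)%N ->
    rat_dlt alpha (m%:R / k%:R) -> dlt_rat alpha (m.+2%:R / k%:R) ->
    ltur (v (x ^+ k)) (C * w x ^+ m).

(** * From comparison up to a constant to equality with a power *)

Section PowerCriterion.
Variables (v : rat -> ureal) (w : rat -> rat) (alpha : dreal).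
Hypothesis v_abs : absolute_value v.
Hypothesis w_ge0 : forall x, 0 <= w x.
Hypothesis w0 : w 0 = 0.
Hypothesis w1 : w 1 = 1.
Hypothesis wM : {morph w : x y / x * y}.
Hypothesis alpha_gt0 : dpos alpha.

Lemma quasi_leM x y : quasi_le v w alpha x -> quasi_le v w alpha y ->
  quasi_le v w alpha (x * y).
Proof.
move=> [C C0 xC] [D D0 yD]; exists (C * D); first exact: mulr_gt0.
move=> k m k0 ma am; rewrite wM !exprMn mulrACA.
by apply: abs_lt_mul => //; [apply: xC | apply: yD].
Qed.

Let w_gt0 x : x != 0 -> 0 < w x.
Proof.
move=> x0; rewrite lt_def w_ge0 andbT; apply/eqP => wx0.
by have := wM x x^-1; rewrite divff // w1 wx0 mul0r => /eqP; rewrite oner_eq0.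
Qed.

Lemma abs_lt_of_quasi_le x a q : x != 0 -> quasi_le v w alpha x ->
  w x < a -> rpow_lt a alpha q -> ltur (v x) q.
Proof.
move=> x0 [C C0 xC] wa [q0 [m [k [k0 hm aq]]]].
have a0 : 0 < a by apply: le_lt_trans wa.
(* The summand C / a^2 pays for replacing M by M + 2 when a <= 1. *)
pose D := C + C / a ^+ 2.
have Ca0 : 0 < C / a ^+ 2 by rewrite divr_gt0 ?exprn_gt0.
have am0 : 0 < a ^ m by apply: exprz_gt0.
have D0 : 0 < D by apply: addr_gt0.
have [a_ge0 C_ge0 D_ge0] : [/\ 0 <= a, 0 <= C & 0 <= D] by rewrite !ltW.
(* K is so large that the gap between a^m and q^k absorbs D^k; then |x|^K < q^K follows after
   raising to the power k. *)
have [|K K0] := @exp_gt_linear (q ^+ k / a ^ m) (D ^+ k) 0 0.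
  by rewrite ltr_pdivlMr // mul1r.
rewrite mul0r addr0 expr_div_n ltr_pdivlMr ?exprn_gt0 // => DK.
have [M [Ma aM]] := dreal_grid K0 alpha_gt0.
have cross (i j : int) (s t : nat) : (0 < s)%N -> (0 < t)%N ->
    i%:~R / s%:R < j%:~R / t%:R :> rat -> i * t%:Z <= j * s%:Z.
  move=> s0 t0; rewrite ltr_pdivrMr ?ltr0n // mulrAC ltr_pdivlMr ?ltr0n //.
  by rewrite -[s%:R]/(s%:Z%:~R) -[t%:R]/(t%:Z%:~R) -!intrM ltr_int => /ltW.
have CD : (C * a ^+ M) ^+ k <= D ^+ k * (a ^ m) ^+ K.
  case: hm => [[a1 /(dreal_lt Ma) lt]|[a1 /dreal_lt/(_ aM) lt]].
    have /= := cross M%:Z m K k K0 k0 lt => le.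
    rewrite exprMn ler_pM ?exprn_ge0 //.
      by rewrite lerXn2r // lerDl ltW.
    by rewrite -exprM ![_ ^+ _]exprnP exprz_exp ler_weXz2l // PoszM.
  have /= := cross m M.+2%:Z k K k0 K0 lt => le.
  have -> : C * a ^+ M = C / a ^+ 2 * a ^+ M.+2.
    rewrite -(addn2 M) (exprD a M) [a ^+ M * _]mulrC mulrA.
    by rewrite divfK ?gt_eqF ?exprn_gt0.
  rewrite exprMn ler_pM ?exprn_ge0 ?divr_ge0 ?mulr_ge0 //.
    by rewrite lerXn2r ?nnegrE ?divr_ge0 ?exprn_ge0 // lerDr ltW.
  rewrite -exprM ![_ ^+ _]exprnP exprz_exp -(subrK (m * K%:Z) (M.+2 * k)%N%:Z).
  have : 0 <= (M.+2 * k)%N%:Z - m * K%:Z by rewrite subr_ge0 PoszM.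
  case: (_ - _) => // i _; rewrite expfzDr ?gt_eqF // ler_piMl ?exprz_ge0 //.
  by rewrite exprn_ile1.
apply/(abs_lt_expE v_abs x K0 q0); apply: ltur_le (xC K M K0 Ma aM).
apply: (@le_trans _ _ (C * a ^+ M)).
  by rewrite ler_pM2l // lerXn2r ?nnegrE // ltW.
rewrite -(ler_pXn2r k0) ?nnegrE ?mulr_ge0 ?exprn_ge0 // ?(ltW q0) //.
by rewrite (le_trans CD) // -exprM mulnC exprM ltW.
Qed.

Lemma rpow_lt_of_abs_lt x q : x != 0 -> quasi_le v w alpha x^-1 ->
  ltur (v x) q -> exists2 a, w x < a & rpow_lt a alpha q.
Proof.
move=> x0 [C C0 xC] xq; have q0 := ltur_gt0 xq.
have [c cq xc] := ltur_round xq; have c0 := ltur_gt0 xc.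
have W0 := w_gt0 x0; have W_ge0 := ltW W0.
(* D dominates both C and C w(x)^2, as needed below for the exponents M and M + 2. *)
pose D := C * (1 + w x ^+ 2).
have W20 : 0 < w x ^+ 2 by rewrite exprn_gt0.
have CD : C <= D by rewrite ler_pMr //; lra.
have CWD : C * w x ^+ 2 <= D by rewrite ler_pM2l //; lra.
have [|K K0] := @exp_gt_linear (q / c) D 0 0.
  by rewrite ltr_pdivlMr // mul1r.
rewrite mul0r addr0 expr_div_n ltr_pdivlMr ?exprn_gt0 // => DK.
have [M [Ma aM]] := dreal_grid K0 alpha_gt0.
have cK0 : 0 < c ^+ K by rewrite exprn_gt0.
have WM : w x ^+ M < C * c ^+ K.
  have wxV : w x^-1 = (w x)^-1.
    by apply: (mulfI (lt0r_neq0 W0)); rewrite -wM !divff ?w1 // lt0r_neq0.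
  have := xC K M K0 Ma aM; rewrite exprVn wxV exprVn.
  move=> /(abs_inv_gt1 v_abs (expf_neq0 K x0) (abs_lt_exp v_abs K0 xc)).
  by rewrite mulrA ltr_pdivlMr ?exprn_gt0 // mul1r mulrC.
(* [rpow_lt] wants a fraction above alpha for a base at least 1, here (M + 2) / K, and one below
   alpha for a base at most 1, here M / K with a capped by 1. *)
case: (leP 1 (w x)) => [W1|W1].
  have [||a /andP[Wa _] aq] :=
    @exists_gt_exp_lt (w x) (w x + 1) (q ^+ K) M.+2 W0.
  - by lra.
  - rewrite -(addn2 M) (exprD _ M); apply: le_lt_trans DK.
    apply: (@le_trans _ _ (C * c ^+ K * w x ^+ 2)).
      by rewrite ler_pM2r ?ltW.
    by rewrite mulrAC ler_pM2r.
  exists a => //; split=> //; exists M.+2%:Z, K; split=> //.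
  by left; split=> //; lra.
have [|a /andP[Wa a1] aq] := @exists_gt_exp_lt (w x) 1 (q ^+ K) M W0 W1.
  apply: lt_trans WM _; apply: le_lt_trans DK.
  by rewrite ler_pM2r.
exists a => //; split=> //; exists M%:Z, K; split=> //.
by right.
Qed.

Lemma is_power_of_quasi_le :
  (forall x, x != 0 -> quasi_le v w alpha x) ->
  is_power_of v (fun x => urat (w_ge0 x)) alpha.
Proof.
move=> vw x q; have [->|x0] := eqVneq x 0; last first.
  split=> [/(rpow_lt_of_abs_lt x0 (vw _ (invr_neq0 x0)))[a]|].
    by exists a.
  by case=> a; apply: abs_lt_of_quasi_le x0 (vw x x0).
split=> [/(abs0_lt v_abs) q0|[a _ [q0 _]]]; last exact/(abs0_lt v_abs).
(* At x = 0 any a <= 1 with a < q^(denq r) works, because numq r >= 1 gives a^(numq r) <= a. *)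
have [r r0 ra] := rat_dlt_round alpha_gt0.
have qk0 : 0 < q ^+ `|denq r| by rewrite exprn_gt0.
have a0 : 0 < Num.min 1 (q ^+ `|denq r| / 2) by rewrite lt_min; lra.
exists (Num.min 1 (q ^+ `|denq r| / 2)); first by rewrite /= w0.
split=> //; exists (numq r), `|denq r|%N; split; first exact: absz_denq_gt0.
  right; split; first by rewrite ge_min lexx.
  by rewrite pmulrn absz_denq divq_num_den.
have : 0 < numq r by rewrite numq_gt0.
case: (numq r) => // -[//|n] _; rewrite -exprnP.
have a1 : Num.min 1 (q ^+ `|denq r| / 2) <= 1 by rewrite ge_min lexx.
apply: le_lt_trans (ler_iXnr _ (ltW a0) a1) _ => //.
by rewrite gt_min; apply/orP; right; lra.
Qed.

End PowerCriterion.

(** * Digit expansions and reduction to primes *)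

Section Ostrowski.
Variable v : rat -> ureal.
Hypothesis v_abs : absolute_value v.

(** Horner's scheme: the digits are below b, and c^i <= c^t for i <= t since c >= 1. The factor t +
    1 in place of t keeps the bound strict at t = 0. *)
Lemma abs_lt_digits b c t N : (1 < b)%N -> 1 <= c -> ltur (v b%:R) c ->
  (N < b ^ t)%N -> ltur (v N%:R) (t.+1%:R * b%:R * c ^+ t).
Proof.
move=> b1 c1 bc; have b0 : 0 < b%:R :> rat by rewrite ltr0n; lia.
elim: t N => [|t IHt] N.
  rewrite expn0 ltnS leqn0 => /eqP ->.
  by apply/(abs0_lt v_abs); rewrite mul1r mulr1.
rewrite expnS => Nb; rewrite (divn_eq N b) natrD natrM [_ * b%:R]mulrC.
have ct1 : 1 <= c ^+ t.+1 by apply: exprn_ege1.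
have q_lt : (N %/ b < b ^ t)%N by rewrite ltn_divLR 1?mulnC //; lia.
have r_lt : (N %% b)%:R < b%:R :> rat by rewrite ltr_nat ltn_mod; lia.
apply: ltur_le (abs_lt_add v_abs (abs_lt_mul v_abs bc (IHt _ q_lt))
  (abs_natr_lt v_abs r_lt)).
rewrite mulrCA -exprS -[t.+2%:R]natr1 [_ + 1]addrC.
by rewrite mulrDl mul1r mulrDl addrC lerD2r ler_peMr // ltW.
Qed.

Lemma abs_lt_subpower a b c s t q : (1 < b)%N -> 1 <= c -> ltur (v b%:R) c ->
  (a ^ s < b ^ t)%N -> c ^+ t < q -> ltur (v (a%:R ^+ s)) q.
Proof.
move=> b1 c1 bc ab cq; have c0 : 0 < c ^+ t by rewrite exprn_gt0 //; lra.
(* The factor (t j + 1) b in the digit bound for a^(s j) is linear in j, hence below (q / c^t)^j for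
   some j. *)
have [|j j0] := @exp_gt_linear (q / c ^+ t) b%:R (t%:R * b%:R) 0.
  by rewrite ltr_pdivlMr // mul1r.
rewrite expr_div_n ltr_pdivlMr ?(exprn_gt0 j c0) // => /ltW jq.
apply/(abs_lt_expE v_abs _ j0); first exact: lt_trans cq.
apply: ltur_le jq _; rewrite -exprM -natrX.
have := @abs_lt_digits b c (t * j) (a ^ (s * j)) b1 c1 bc.
rewrite !expnM ltn_exp2r // => /(_ ab).
by rewrite -exprM -natr1 natrM mulrDl mul1r [_ + b%:R]addrC mulrAC.
Qed.

(** In logarithms, log_b |b| < m / k implies log |a| <= (m / k) log a: a^s is squeezed between b^t
    and b^(t + 1), and s grows. *)
Lemma abs_lt_transfer a b k (m : nat) q : (1 < b)%N -> (0 < a)%N -> (0 < k)%N ->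
  ltur (v (b%:R ^+ k)) (b%:R ^+ m) -> a%:R ^+ m < q -> ltur (v (a%:R ^+ k)) q.
Proof.
move=> b1 a0 k0 /(abs_lt_root v_abs)[c0 bc0 c0m] aq.
have b_ge1 : 1 <= b%:R :> rat by rewrite ler1n ltnW.
have am0 : 0 < a%:R ^+ m :> rat by rewrite exprn_gt0 ?ltr0n.
(* The digit bound needs c >= 1; the maximum preserves c^k <= b^m because b^m >= 1. *)
pose c := Num.max 1 c0; have c1 : 1 <= c by rewrite le_max lexx.
have c_ge0 : 0 <= c by lra.
have bc : ltur (v b%:R) c by apply: ltur_le bc0; rewrite le_max lexx orbT.
have cm : c ^+ k <= b%:R ^+ m.
  by rewrite /c; case: (leP 1 c0) => // _; rewrite expr1n exprn_ege1.
(* The factor b^m pays for rounding the exponent up to t + 1, and 2^k for the strict bound 2 c^(t +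
   1). *)
have [|s s0] := @exp_gt_linear (q / a%:R ^+ m) (2 ^+ k * b%:R ^+ m) 0 0.
  by rewrite ltr_pdivlMr // mul1r.
rewrite mul0r addr0 expr_div_n ltr_pdivlMr ?(exprn_gt0 s am0) // => /ltW sq.
have as0 : (0 < a ^ s)%N by rewrite expn_gt0 a0.
have /andP[ba ab] := trunc_log_bounds b1 as0.
set t := trunc_log b (a ^ s) in ba ab.
have ct : c ^+ t.+1 < 2 * c ^+ t.+1.
  by rewrite ltr_pMl ?exprn_gt0 //; lra.
have /(abs_lt_exp v_abs k0) := abs_lt_subpower b1 c1 bc ab ct.
move=> ask; apply/(abs_lt_expE v_abs _ s0); first exact: lt_trans aq.
rewrite -exprM mulnC exprM; apply: ltur_le ask; apply: le_trans sq.
rewrite exprMn -mulrA ler_pM2l ?exprn_gt0 // -exprM mulnC exprM.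
apply: (@le_trans _ _ ((b%:R ^+ m) ^+ t.+1)).
  by rewrite lerXn2r ?nnegrE ?exprn_ge0.
rewrite exprS ler_pM2l ?exprn_gt0 ?ltr0n ?(ltnW b1) //.
rewrite -!exprM ![(m * _)%N]mulnC !exprM.
by rewrite lerXn2r ?nnegrE ?exprn_ge0 // -!natrX ler_nat.
Qed.

Lemma quasi_le1 (w : rat -> rat) alpha : w 1 = 1 -> quasi_le v w alpha 1.
Proof.
move=> w1; exists 2 => // k m _ _ _.
by rewrite w1 !expr1n; apply/(abs1_lt v_abs).
Qed.

Lemma quasi_le_primes (w : rat -> rat) alpha :
  (forall x, 0 <= w x) -> w 1 = 1 ->
  {morph w : x y / x * y} ->
  (forall p, prime p ->
    quasi_le v w alpha p%:R /\ quasi_le v w alpha p%:R^-1) ->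
  forall x, x != 0 -> quasi_le v w alpha x.
Proof.
move=> w_ge0 w1 wM wp.
have wN1 : w (- 1) = 1.
  by apply/eqP; rewrite -sqrp_eq1 // expr2 -wM mulrNN mulr1 w1.
have PN1 : quasi_le v w alpha (- 1).
  exists 2 => // k m _ _ _; rewrite wN1 expr1n -signr_odd.
  by case: odd; [apply: absN1_lt|apply/(abs1_lt v_abs)].
have Pnat n : (0 < n)%N ->
    quasi_le v w alpha n%:R /\ quasi_le v w alpha n%:R^-1.
  elim/ltn_ind: n => n IHn n0; have [n1|n1] := leqP n 1.
    by rewrite (_ : n = 1%N) ?invr1; [split; apply: quasi_le1 | lia].
  have pr := pdiv_prime n1; have dv := pdiv_dvd n.
  rewrite -(divnK dv) natrM invfM.
  have q_lt : (n %/ pdiv n < n)%N by rewrite ltn_Pdiv ?prime_gt1.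
  have q_gt0 : (0 < n %/ pdiv n)%N by rewrite divn_gt0 ?pdiv_gt0 // dvdn_leq.
  have [q1 q2] := IHn _ q_lt q_gt0.
  have [p1 p2] := wp _ pr.
  by split; apply: quasi_leM.
move=> x x0; have dE : (denq x)%:~R = `|denq x|%N%:R :> rat.
  by rewrite pmulrn absz_denq.
rewrite -(divq_num_den x) dE.
have [_ Pd] := Pnat _ (absz_denq_gt0 x).
apply: quasi_leM => //.
have nx0 : (0 < `|numq x|)%N by rewrite absz_gt0 numq_eq0.
have [Pn _] := Pnat _ nx0; rewrite [numq x]intEsign intrM -pmulrn.
case: (numq x < 0); last by rewrite mul1r.
exact: quasi_leM.
Qed.

End Ostrowski.

(** * The logarithm at non-negative fractions *)

Lemma dlog_upperP v (v_abs : absolute_value v) b (b1 : 1 < b) x (x0 : x != 0)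
    (m k : nat) : (0 < k)%N ->
  dlt_rat (dlog v_abs b1 x0) (m%:R / k%:R) <-> ltur (v (x ^+ k)) (b ^+ m).
Proof. exact: (@log_ltP v v_abs b b1 x m%:Z k). Qed.

Lemma dlog_lowerP v (v_abs : absolute_value v) b (b1 : 1 < b) x (x0 : x != 0)
    (m k : nat) : (0 < k)%N ->
  rat_dlt (dlog v_abs b1 x0) (m%:R / k%:R) <-> ltur (v (x ^- k)) (b ^- m).
Proof.
move=> k0; apply: iff_trans (@log_gtP v v_abs b b1 x m%:Z k k0) _.
by rewrite -invr_expz.
Qed.

Lemma dlog_gt0 v (v_abs : absolute_value v) b (b1 : 1 < b) x (x0 : x != 0) :
  ltur (v x^-1) 1 -> dpos (dlog v_abs b1 x0).
Proof.
move=> xV; rewrite /dpos -[0](mul0r (1%:R^-1)).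
by apply/(@dlog_lowerP _ _ _ _ _ _ 0 1) => //; rewrite expr1 expr0 invr1.
Qed.

(** * The Archimedean case *)

Section Archimedean.
Variables (v : rat -> ureal) (v_abs : absolute_value v) (b : nat).
Hypotheses (b_gt1 : 1 < b%:R :> rat) (b_neq0 : b%:R != 0 :> rat).
Hypothesis vb : ltur (v b%:R^-1) 1.
(** The exponent log_b |b|, forced by |b| = b^alpha. *)
Let alpha := dlog v_abs b_gt1 b_neq0.

Let bN : (1 < b)%N. Proof. by rewrite -(ltr1n rat). Qed.

Lemma dlog_nat_le1 : dle1 alpha.
Proof.
move=> q q1; rewrite /= /log_lt; have dq := absz_denq_gt0 q.
have : denq q < numq q.
  rewrite -(ltr_int rat) -[X in X < _]mul1r.
  by rewrite -ltr_pdivlMr ?ltr0z ?denq_gt0 // divq_num_den.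
have := denq_gt0 q; case: (denq q) => // d d0; case: (numq q) => // n.
rewrite ltz_nat => dn; rewrite -natrX -exprnP -natrX; apply: abs_natr_lt => //.
by rewrite ltr_nat ltn_exp2l.
Qed.

Lemma quasi_le_nat n : (0 < n)%N -> quasi_le v Num.norm alpha n%:R.
Proof.
move=> n0; have nR : 0 < n%:R :> rat by rewrite ltr0n.
(* Transfer from b gives |n|^k <= n^(m + 2); n^2 covers the shift by 2 and the factor 2 makes the
   bound strict. *)
exists (2 * n%:R ^+ 2); first by rewrite mulr_gt0 ?exprn_gt0.
move=> k m k0 _ /dlog_upperP - /(_ k0) bk.
apply: (abs_lt_transfer v_abs bN n0 k0 bk).
rewrite normr_nat -mulrA -exprD add2n ltr_pMl ?exprn_gt0 //.
Qed.

(** Here log_n |n| is located between m / k and some r < alpha. If it were below r, transfer from n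
    to b would bound log_b |b| by r, against r < alpha. *)
Lemma quasi_le_natV n : (1 < n)%N -> quasi_le v Num.norm alpha n%:R^-1.
Proof.
move=> n1; have nR : 1 < n%:R :> rat by rewrite ltr1n.
have n0 : n%:R != 0 :> rat by rewrite gt_eqF //; lra.
exists 1 => // k m k0 /rat_dlt_round[r mr ra] _.
rewrite mul1r ger0_norm ?invr_ge0 // !exprVn.
case: (dreal_located (dlog v_abs nR n0) mr) => [/dlog_lowerP|]; first exact.
have r0 : 0 <= r by apply: le_trans (ltW mr); rewrite divr_ge0.
have rE : r = `|numq r|%N%:R / `|denq r|%N%:R.
  by rewrite !pmulrn absz_denq gez0_abs ?numq_ge0 // divq_num_den.
move: ra; rewrite rE; have := absz_denq_gt0 r.
move: `|denq r|%N `|numq r|%N => k' m' k'0.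
move=> /dlog_lowerP - /(_ k'0) /ltur_round[q qb bVq] /dlog_upperP - /(_ k'0) nk.
have q0 := ltur_gt0 bVq.
have bq : b%:R ^+ m' < q^-1.
  rewrite -[X in X < _]invrK ltf_pV2 // posrE invr_gt0.
  by rewrite exprn_gt0 // ltr0n ltnW.
have bk := abs_lt_transfer v_abs n1 (ltnW bN) k'0 nk bq.
have := abs_inv_gt1 v_abs (expf_neq0 k' b_neq0) bk bVq.
by rewrite mulVf ?gt_eqF // ltxx.
Qed.

Lemma archimedean_power : is_power_of v abs_infty alpha.
Proof.
apply: (@is_power_of_quasi_le v Num.norm alpha v_abs (@normr_ge0 _ _)).
- exact: normr0.
- exact: normr1.
- exact: normrM.
- exact: dlog_gt0.
apply: (quasi_le_primes v_abs (@normr_ge0 _ _) (normr1 _) (@normrM _)).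
move=> p p_prime; split; first exact/quasi_le_nat/prime_gt0.
exact/quasi_le_natV/prime_gt1.
Qed.

End Archimedean.

(** * The non-Archimedean case *)

Section Padic.
Variables (p : nat) (p_prime : prime p).

Lemma padic_int_gt0 n : n != 0 -> 0 < padic_int p n.
Proof.
move=> n0; rewrite /padic_int (negbTE n0) invr_gt0 exprn_gt0 //.
by rewrite ltr0n prime_gt0.
Qed.

Lemma padic_intM : {morph padic_int p : m n / (m * n)%R >-> m * n}.
Proof.
move=> m n; rewrite /padic_int mulf_eq0.
have [_|m0] := eqVneq m 0; first by rewrite mul0r.
have [_|n0] := eqVneq n 0; first by rewrite mulr0.
by rewrite abszM lognM ?absz_gt0 // exprD invfM.
Qed.

(** Multiplicativity on integers and cross multiplication make the quotient independent of the
    chosen fraction. *)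
Lemma padic_ratE (x : rat) (m n : int) : n != 0 -> x = m%:~R / n%:~R ->
  padic_rat p x = padic_int p m / padic_int p n.
Proof.
move=> n0 xE; have dP := padic_int_gt0 (denq_neq0 x).
apply/eqP; rewrite eqr_div ?lt0r_neq0 ?padic_int_gt0 // -!padic_intM; apply/eqP.
congr padic_int; apply/eqP; rewrite -(eqr_int rat) !intrM.
by rewrite -eqr_div ?intr_eq0 ?denq_neq0 // divq_num_den -xE.
Qed.

Lemma padic_ratM : {morph padic_rat p : x y / x * y}.
Proof.
move=> x y; rewrite (@padic_ratE (x * y) (numq x * numq y) (denq x * denq y)).
- by rewrite !padic_intM invfM mulrACA.
- by rewrite mulf_neq0 ?denq_neq0.
- by rewrite !intrM -mulf_div !divq_num_den.
Qed.

Lemma padic_rat_nat n : (0 < n)%N -> padic_rat p n%:R = p%:R ^- logn p n.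
Proof.
move=> n0; rewrite (@padic_ratE _ n 1) //; last by rewrite divr1.
by rewrite /padic_int /= logn1 expr0 invr1 divr1 eqz_nat gtn_eqF.
Qed.

Lemma padic_rat1 : padic_rat p 1 = 1.
Proof. by rewrite (@padic_rat_nat 1) // logn1 expr0 invr1. Qed.

Lemma padic_ratV n : (0 < n)%N -> padic_rat p n%:R^-1 = p%:R ^+ logn p n.
Proof.
move=> n0; have nR : n%:R != 0 :> rat by rewrite pnatr_eq0 -lt0n.
have pn0 : p%:R ^+ logn p n != 0 :> rat.
  by rewrite expf_neq0 // pnatr_eq0 -lt0n prime_gt0.
have := padic_ratM n%:R n%:R^-1.
rewrite divff // padic_rat1 padic_rat_nat // => h.
by apply: (mulfI (invr_neq0 pn0)); rewrite -h mulVf.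
Qed.

Lemma padic_rat0 : padic_rat p 0 = 0.
Proof.
rewrite /padic_rat (_ : numq 0 = 0) // [X in X / _]/padic_int.
by rewrite eqxx mul0r.
Qed.

Variables (v : rat -> ureal) (v_abs : absolute_value v).
Hypotheses (p_gt1 : 1 < p%:R :> rat) (pV_neq0 : p%:R^-1 != 0 :> rat).
Hypothesis vp : ltur (v p%:R) 1.
(** The exponent log_p |p^-1|, forced by |p| = p^(- alpha). *)
Let alpha := dlog v_abs p_gt1 pV_neq0.

(** Expansion in base p with c = 1, starting from n < p^n. *)
Lemma abs_lt_nat_padic n q : 1 < q -> ltur (v n%:R) q.
Proof.
move=> q1; rewrite -[n%:R]expr1.
apply: (@abs_lt_subpower v v_abs n p 1 1 n); rewrite ?expr1n ?prime_gt1 //.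
by rewrite expn1 ltn_expl ?prime_gt1.
Qed.

(** Bezout's identity s n = t p^j + 1 gives n^-1 = s - t p^j n^-1, where |s| <= 1 and the last term
    tends to 0 as j grows. *)
Lemma abs_lt_coprimeV n q :
  (0 < n)%N -> coprime p n -> 1 < q -> ltur (v n%:R^-1) q.
Proof.
move=> n0 pn q1; have nR : n%:R != 0 :> rat by rewrite pnatr_eq0 -lt0n.
have [B nB] := ltur_fin (v n%:R^-1); have B0 := ltur_gt0 nB.
have [c c1 pc] := ltur_round vp; have c0 := ltur_gt0 pc.
pose e := (q - 1) / 2; have e0 : 0 < e by rewrite /e; lra.
(* This j yields (1 + e) B c^j < e, which bounds t p^j n^-1. *)
have [|j j0] := @exp_gt_linear c^-1 ((1 + e) * B / e) 0 0.
  by rewrite -invr1 ltf_pV2 ?posrE.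
rewrite mul0r addr0 ltr_pdivrMr // exprVn.
rewrite [X in _ < X]mulrC ltr_pdivlMr ?exprn_gt0 // => cB.
have pj0 : (0 < p ^ j)%N by rewrite expn_gt0 prime_gt0.
have cop : coprime n (p ^ j) by rewrite coprimeXr // coprime_sym.
have [[s t] /= st] : {st : nat * nat | (st.1 * n = st.2 * p ^ j + 1)%N}.
  by case: (egcdnP (p ^ j) n0) => s t; rewrite (eqP cop) => h _; exists (s, t).
have -> : n%:R^-1 = s%:R - t%:R * (p%:R ^+ j * n%:R^-1) :> rat.
  apply: (mulIf nR); rewrite mulVf // mulrBl -!mulrA mulVf // mulr1.
  by rewrite -natrX -!natrM st natrD addrC addKr.
have -> : q = (1 + e) + e by rewrite /e; lra.
apply: abs_lt_add => //; first by apply: abs_lt_nat_padic; lra.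
apply: absN_lt => //; apply: ltur_up cB _.
rewrite -mulrA [B * _]mulrC; apply: abs_lt_mul => //.
  by apply: abs_lt_nat_padic; lra.
by apply: abs_lt_mul => //; apply: abs_lt_exp.
Qed.

Lemma padic_power : is_power_of v (abs_padic p) alpha.
Proof.
have p0 := prime_gt0 p_prime; have pR : 0 < p%:R :> rat by rewrite ltr0n.
apply: (@is_power_of_quasi_le v (padic_rat p) alpha v_abs (padic_rat_ge0 p)).
- exact: padic_rat0.
- exact: padic_rat1.
- exact: padic_ratM.
- by apply: dlog_gt0; rewrite invrK.
apply: (quasi_le_primes v_abs (padic_rat_ge0 p) padic_rat1 padic_ratM).
move=> r r_prime; have r0 := prime_gt0 r_prime.
have [->|rp] := eqVneq r p.
  split.
    exists 1 => // k m k0 /dlog_lowerP - /(_ k0) pk _.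
    rewrite mul1r padic_rat_nat // logn_prime // eqxx expr1 exprVn.
    by rewrite exprVn invrK in pk.
  (* The upper section of alpha bounds |p^-1|^k by p^(m + 2), hence the constant p^2. *)
  exists (p%:R ^+ 2) => [|k m k0 _ /dlog_upperP - /(_ k0)].
    by rewrite exprn_gt0.
  by rewrite padic_ratV // logn_prime // eqxx expr1 -exprD add2n.
have cop : coprime p r by rewrite prime_coprime // dvdn_prime2 // eq_sym.
have lr : logn p r = 0%N by rewrite logn_prime // eq_sym (negbTE rp).
(* Away from p, |r|_p = 1 and all powers of r and r^-1 have absolute value at most 1, so a constant
   above 1 suffices. *)
split; exists 2 => // k m k0 _ _.
  rewrite padic_rat_nat // lr expr0 invr1 expr1n mulr1 -natrX.
  exact: abs_lt_nat_padic.
rewrite padic_ratV // lr expr0 expr1n mulr1 exprVn -natrX.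
by apply: abs_lt_coprimeV; rewrite ?expn_gt0 ?r0 // coprimeXr.
Qed.

End Padic.

(** * Choice of the base and conclusion *)

(** The bound 1 on |n| splits as a c over n / [pdiv n] and [pdiv n]. Either c <= 1 and the prime is
    found, or a <= 1 and the search continues in the cofactor. *)
Lemma exists_prime_abs_lt1 (v : rat -> ureal) n :
  absolute_value v -> (0 < n)%N -> ltur (v n%:R) 1 ->
  exists2 p, prime p & ltur (v p%:R) 1.
Proof.
move=> v_abs; elim/ltn_ind: n => n IHn n0; have [n1|n1] := leqP n 1.
  by rewrite (_ : n = 1%N); [move=> /(abs1_lt v_abs); rewrite ltxx | lia].
have pr := pdiv_prime n1; have dv := pdiv_dvd n.
rewrite -{1}(divnK dv) natrM => /(absM v_abs)[a [c [na pc ac]]].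
have [c1|c1] := leP c 1; first by exists (pdiv n) => //; apply: ltur_le pc.
apply: (IHn (n %/ pdiv n)%N); first by rewrite ltn_Pdiv ?prime_gt1.
  by rewrite divn_gt0 ?pdiv_gt0 // dvdn_leq.
have a0 := ltur_gt0 na; apply: ltur_le na.
by rewrite ac ler_peMr ?(ltW a0) ?(ltW c1).
Qed.

Lemma abs_lt_absz (v : rat -> ureal) (n : int) q : absolute_value v ->
  (ltur (v n%:~R) q -> ltur (v `|n|%N%:R) q) /\
  (ltur (v n%:~R^-1) q -> ltur (v `|n|%N%:R^-1) q).
Proof.
move=> v_abs; rewrite -[`|n|%N%:R]/(`|n|%N%:Z%:~R) abszE.
case: (ger0P n) => // _; rewrite intrN invrN.
by split=> /(absN_lt v_abs).
Qed.

Lemma ltru1_absV (v : rat -> ureal) x : absolute_value v -> x != 0 ->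
  ltru 1 (v x) -> ltur (v x^-1) 1.
Proof.
move=> v_abs x0 [r r1 xr].
case: (abs_locate v_abs x0 ltr01 r1) => [|/ltur_round[s sr /xr]].
  by rewrite invr1.
by rewrite leNgt sr.
Qed.

Theorem theorem5p8 (v : rat -> ureal) (v_abs : absolute_value v)
    (v_nontrivial : nontrivial v) :
  (exists alpha : dreal,
     [/\ dpos alpha, dle1 alpha & is_power_of v abs_infty alpha])
  \/
  (exists (alpha : dreal) (p : nat),
     [/\ dpos alpha, prime p & is_power_of v (abs_padic p) alpha]).
Proof.
case: v_nontrivial => [[n n0 vn]|[n n0 vn]]; [right|left].
  have := proj1 (abs_lt_absz n 1 v_abs) vn; case/exists_prime_abs_lt1 => //.
    by rewrite absz_gt0.
  move=> p p_prime vp.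
  have p1 : 1 < p%:R :> rat by rewrite ltr1n prime_gt1.
  have p0 : p%:R^-1 != 0 :> rat by rewrite invr_eq0 gt_eqF //; lra.
  exists (dlog v_abs p1 p0), p; split=> //; last exact: padic_power.
  by apply: dlog_gt0; rewrite invrK.
have nR : n%:~R != 0 :> rat by rewrite intr_eq0.
have vV := proj2 (abs_lt_absz n 1 v_abs) (ltru1_absV v_abs nR vn).
have a0 : `|n|%N%:R != 0 :> rat by rewrite pnatr_eq0 absz_eq0.
(* If n were 1 or -1, the bound [vV] would say |1| < 1. *)
have a1 : 1 < `|n|%N%:R :> rat.
  rewrite ltr1n; move: vV; case: ltngtP => //.
    by case: n n0 {vn nR a0} => // -[].
  by move=> <-; rewrite invr1 => /(abs1_lt v_abs); rewrite ltxx.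
exists (dlog v_abs a1 a0); split; [exact: dlog_gt0|exact: dlog_nat_le1|].
exact: archimedean_power.
Qed.
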